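(* Let $\alpha\in(1,2]$ and $f\in\mathcal{F}_\alpha$. Then there exists $x\in\mathbb{C}$ with $|x|=1$, $x\neq -1$, such that $$f(z)\prec\left(\frac{1+xz}{1-z}\right)^{\alpha}.$$
   Context: $\mathbb{D}=\{z\in\mathbb{C}:|z|<1\}$. For $\alpha\in(1,2]$, $\mathcal{F}_\alpha$ is the class of functions $f$ that are analytic, univalent and non-vanishing in $\mathbb{D}$, such that the complement $\mathbb{C}\setminus f(\mathbb{D})$ is a convex set, $f(1)=\infty$, $f(0)=1$, and the opening angle of $f(\mathbb{D})$ at $\infty$ is at most $\pi\alpha$. (The opening angle at $\infty$ is $2\pi$ minus the angle of the recession cone of the unbounded closed convex set $\mathbb{C}\setminus f(\mathbb{D})$.) For analytic $f,F$ in $\mathbb{D}$, $f\prec F$ (subordination) means $f=F\circ\varphi$ for some analytic $\varphi$ on $\mathbb{D}$ with $\varphi(0)=0$ and $\varphi(\mathbb{D})\subset\mathbb{D}$. The power is the branch taking the value $1$ at $z=0$. *)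

(* Defs.v *)
From Stdlib Require Import Reals.
From Coquelicot Require Import Coquelicot.

Open Scope R_scope.

Definition disc (z : C) : Prop := Cmod z < 1.

(* Analytic is understood as complex differentiable at every point of the open
   unit disc.  Values outside the disc play no role. *)
Definition analytic_on_disc (f : C -> C) : Prop :=
  forall z : C, disc z ->
    ex_derive (K := C_AbsRing) (V := C_NormedModule) f z.

Definition univalent_on_disc (f : C -> C) : Prop :=
  forall z w : C, disc z -> disc w -> f z = f w -> z = w.

Definition disc_image (f : C -> C) (w : C) : Prop :=
  exists z : C, disc z /\ w = f z.

Definition compl (A : C -> Prop) (w : C) : Prop := ~ A w.

Definition convex_set (K : C -> Prop) : Prop :=
  forall (p q : C) (t : R), K p -> K q -> 0 <= t <= 1 ->
    K (RtoC (1 - t) * p + RtoC t * q)%C.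

Definition recession_cone (K : C -> Prop) (d : C) : Prop :=
  forall (p : C) (t : R), K p -> 0 <= t -> K (p + RtoC t * d)%C.

(* [T] is the closed sector with vertex 0 cut out by an arc of directions of
   length [beta].  [beta] is determined by [T]; the value 0 is a single ray, PI
   a closed half-plane.  The cones {0} and a full line have no angle in this
   sense, but they do not occur as recession cones of complements of f(D) in
   the class below: such a complement is nonempty and unbounded, and it does
   not separate the plane. *)
Definition cone_angle (T : C -> Prop) (beta : R) : Prop :=
  0 <= beta <= 2 * PI /\
  exists theta0 : R, forall w : C,
    T w <-> exists r theta : R,
      0 <= r /\ theta0 <= theta <= theta0 + beta /\
      w = (RtoC r * (cos theta, sin theta))%C.

Definition opening_angle_at_infinity (Omega : C -> Prop) (gamma : R) : Prop :=
  exists beta : R,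
    cone_angle (recession_cone (compl Omega)) beta /\ gamma = 2 * PI - beta.

(* f(1) = oo: |f(z)| -> +oo as z -> 1 inside the disc. *)
Definition infinite_at_one (f : C -> C) : Prop :=
  filterlim (fun z : C => Cmod (f z))
    (within disc (@locally C_UniformSpace (RtoC 1)))
    (Rbar_locally p_infty).

Record class_F (alpha : R) (f : C -> C) : Prop := {
  F_analytic : analytic_on_disc f;
  F_univalent : univalent_on_disc f;
  F_nonvanishing : forall z : C, disc z -> f z <> RtoC 0;
  F_concave : convex_set (compl (disc_image f));
  F_at_one : infinite_at_one f;
  F_normalized : f (RtoC 0) = RtoC 1;
  F_opening : exists gamma : R,
    opening_angle_at_infinity (disc_image f) gamma /\ gamma <= PI * alpha }.

Definition subordinate (f F : C -> C) : Prop :=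
  exists phi : C -> C,
    analytic_on_disc phi /\ phi (RtoC 0) = RtoC 0 /\
    (forall z : C, disc z -> disc (phi z)) /\
    (forall z : C, disc z -> f z = F (phi z)).

Definition Cexp (z : C) : C :=
  (RtoC (exp (Re z)) * (cos (Im z), sin (Im z)))%C.

(* [P] is an analytic branch of h^a on the disc: P = exp (a L) with L an
   analytic branch of log h.  The branch is not yet normalized. *)
Definition power_branch (h : C -> C) (a : R) (P : C -> C) : Prop :=
  exists L : C -> C,
    analytic_on_disc L /\
    (forall z : C, disc z -> Cexp (L z) = h z) /\
    (forall z : C, disc z -> P z = Cexp (RtoC a * L z)%C).

(* Main.v *)
Require Import Defs.
From Stdlib Require Import Reals Lra.
From Coquelicot Require Import Coquelicot.

(* The complement of f(D) contains 0, hence its whole recession cone, so f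
   avoids a closed sector with vertex 0 and angle at least 2 pi - alpha pi.
   Cutting the logarithm along a ray of that sector gives log f with values in
   a horizontal strip of width at most alpha pi, i.e. f^(1/alpha) maps D into an open
   half-plane bounded by a line through 0.  The Moebius maps
   (1 + x z) / (1 - z), |x| = 1, x <> -1, send D onto exactly such half-planes
   containing 1, and phi is the inverse Moebius map composed with
   f^(1/alpha). *)

(** * Complex differentiability in terms of the modulus *)

Notation is_derive_C := (is_derive (K := C_AbsRing) (V := C_NormedModule)).
Notation ex_derive_C := (ex_derive (K := C_AbsRing) (V := C_NormedModule)).
Notation plane := (prod_UniformSpace R_UniformSpace R_UniformSpace).

Lemma is_derive_C_eps (f : C -> C) (z l : C) :
  is_derive_C f z l <->
  forall eps : R, 0 < eps -> exists d : R, 0 < d /\ forall w : C,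
    Cmod (w - z) < d ->
    Cmod (f w - f z - (w - z) * l) <= eps * Cmod (w - z).
Proof.
split.
- intros [_ H] eps He.
  destruct (H z (fun P HP => HP) (mkposreal eps He)) as [d Hd].
  exists d; split; [apply cond_pos|].
  intros w Hw; exact (Hd w Hw).
- intros H; split; [exact (@is_linear_scal_l C_AbsRing C_NormedModule l)|].
  (* The differential is tested at every limit [y] of the filter [locally z], and [z] is the only
     one. *)
  intros y Hy. apply (@is_filter_lim_locally_unique _
    (AbsRing_NormedModule C_AbsRing)) in Hy.
  subst y. intros eps.
  destruct (H eps (cond_pos eps)) as [d [Hd0 Hd]].
  exists (mkposreal d Hd0); intros w Hw; exact (Hd w Hw).
Qed.

(* The two codomains carry different uniform structures (product balls versus
   [Cmod] balls), and chain and product rules need the second one. *)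
Lemma is_derive_C_AbsRing (f : C -> C) (z l : C) :
  is_derive_C f z l <->
  is_derive (K := C_AbsRing) (V := AbsRing_NormedModule C_AbsRing) f z l.
Proof.
split; intros [_ H]; split.
- exact (@is_linear_scal_l C_AbsRing (AbsRing_NormedModule C_AbsRing) l).
- exact H.
- exact (@is_linear_scal_l C_AbsRing C_NormedModule l).
- exact H.
Qed.

(** The modulus dominates the sup norm, so a modulus ball lies in the product ball of the same
    radius. *)
Lemma locally_prod_Cmod (w : C) (Q : C -> Prop) :
  locally (T := plane) w Q ->
  exists r, 0 < r /\ forall w', Cmod (w' - w) < r -> Q w'.
Proof.
intros [d Hd]. exists d; split; [apply cond_pos|]. intros w' Hw'.
apply Hd. pose proof (Rmax_Cmod (w' - w)%C) as Hm.
split; (eapply Rle_lt_trans; [|exact Hw']; eapply Rle_trans; [|exact Hm]).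
- apply Rmax_l.
- apply Rmax_r.
Qed.

(** The two real differentials together are multiplication by [(a, b)]. The complex remainder is
    [p + i q], and each of [p], [q] gets half of [eps]. *)
Lemma is_derive_C_Cauchy_Riemann (u v : R * R -> R) (z : C) (a b : R) :
  filterdiff u (locally (T := plane) z)
    (fun h => a * fst h - b * snd h) ->
  filterdiff v (locally (T := plane) z)
    (fun h => b * fst h + a * snd h) ->
  is_derive_C
    (fun w : C => (u w, v w)) z (a, b).
Proof.
intros [_ Hu] [_ Hv]. apply is_derive_C_eps. intros eps Heps.
assert (Heps2 : 0 < eps / 2) by lra.
destruct (locally_prod_Cmod _ _ (Hu z (fun P HP => HP) (mkposreal _ Heps2)))
  as [d1 [Hd1 H1]].
destruct (locally_prod_Cmod _ _ (Hv z (fun P HP => HP) (mkposreal _ Heps2)))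
  as [d2 [Hd2 H2]].
exists (Rmin d1 d2); split; [now apply Rmin_pos|].
intros w Hw.
specialize (H1 w (Rlt_le_trans _ _ _ Hw (Rmin_l _ _))).
specialize (H2 w (Rlt_le_trans _ _ _ Hw (Rmin_r _ _))).
set (p := u w - u z - (a * (fst w - fst z) - b * (snd w - snd z))).
set (q := v w - v z - (b * (fst w - fst z) + a * (snd w - snd z))).
(* The norm of a product module is Euclidean, hence equal to the modulus. *)
assert (Hn : Cmod (w - z) =
  norm (minus (G := prod_NormedModule R_AbsRing R_NormedModule R_NormedModule) w z)).
{ unfold norm; simpl; unfold prod_norm, norm, Cmod; simpl; unfold abs; simpl.
  rewrite !Rmult_1_r, <- !Rabs_mult, !Rabs_pos_eq; try apply Rle_0_sqr.
  reflexivity. }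
assert (Hp : Rabs p <= eps / 2 * Cmod (w - z)) by (rewrite Hn; exact H1).
assert (Hq : Rabs q <= eps / 2 * Cmod (w - z)) by (rewrite Hn; exact H2).
replace ((u w, v w) - (u z, v z) - (w - z) * (a, b))%C
  with (RtoC p + Ci * RtoC q)%C.
- eapply Rle_trans; [apply Cmod_triangle|].
  rewrite Cmod_mult, Cmod_Ci, !Cmod_R. lra.
- destruct w, z; unfold p, q; apply injective_projections; simpl; ring.
Qed.

Lemma is_derive_Cexp (z : C) :
  is_derive_C Cexp z (Cexp z).
Proof.
apply is_derive_ext with
  (f := fun w : C => (exp (fst w) * cos (snd w), exp (fst w) * sin (snd w))).
{ intros w; unfold Cexp, Re, Im; apply injective_projections; simpl; ring. }
replace (Cexp z) with (exp (fst z) * cos (snd z), exp (fst z) * sin (snd z)).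
2:{ unfold Cexp, Re, Im; apply injective_projections; simpl; ring. }
pose (U := prod_NormedModule R_AbsRing R_NormedModule R_NormedModule).
assert (Hfst : forall (g : R -> R) dg, is_derive g (fst z) dg ->
  filterdiff (fun w : U => g (fst w)) (locally (z : U)) (fun h : U => fst h * dg)).
{ intros g dg Hg.
  exact (filterdiff_comp' (U := U) fst g z _ _
    (filterdiff_linear _ is_linear_fst) Hg). }
assert (Hsnd : forall (g : R -> R) dg, is_derive g (snd z) dg ->
  filterdiff (fun w : U => g (snd w)) (locally (z : U)) (fun h : U => snd h * dg)).
{ intros g dg Hg.
  exact (filterdiff_comp' (U := U) snd g z _ _
    (filterdiff_linear _ is_linear_snd) Hg). }
assert (He := Hfst _ _ (is_derive_exp (fst z))).
assert (Hc := Hsnd _ _ (is_derive_cos (snd z))).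
assert (Hs := Hsnd _ _ (is_derive_sin (snd z))).
apply is_derive_C_Cauchy_Riemann
  with (u := fun w => exp (fst w) * cos (snd w))
       (v := fun w => exp (fst w) * sin (snd w)).
- eapply filterdiff_ext_lin.
  + exact (filterdiff_mult_fct (U := U) _ _ z _ _ Rmult_comm He Hc).
  + intros h; unfold mult, plus; simpl; ring.
- eapply filterdiff_ext_lin.
  + exact (filterdiff_mult_fct (U := U) _ _ z _ _ Rmult_comm He Hs).
  + intros h; unfold mult, plus; simpl; ring.
Qed.

(** With increments [k] of [g] and [h] of its argument, differentiability of [F] gives
    [h = k d + o(k)]. This forces [k = O(h)], so the error is [o(h)], and dividing by [d] gives the
    claim. *)
Lemma is_derive_C_inverse (F g : C -> C) (w d : C) :
  is_derive_C F (g w) d ->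
  d <> RtoC 0 ->
  (forall eps, 0 < eps -> exists r, 0 < r /\
     forall w', Cmod (w' - w) < r -> Cmod (g w' - g w) < eps) ->
  (exists r, 0 < r /\ forall w', Cmod (w' - w) < r -> F (g w') = w') ->
  is_derive_C g w (/ d)%C.
Proof.
intros HF Hd Hg [r0 [Hr0 HFg]]. apply is_derive_C_eps. intros eps Heps.
assert (HD : 0 < Cmod d) by now apply Cmod_gt_0.
(* The first bound yields [|k| |d| <= 2 |h|]; the second then turns the remainder [e |k| / |d|] into
   at most [eps |h|]. *)
pose (e := Rmin (Cmod d / 2) (eps * (Cmod d) ^ 2 / 2)).
assert (He : 0 < e).
{ apply Rmin_pos; [lra|]. apply Rdiv_lt_0_compat; [|lra].
  apply Rmult_lt_0_compat; [easy|]. now apply pow_lt. }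
destruct (proj1 (is_derive_C_eps _ _ _) HF e He) as [r1 [Hr1 H1]].
destruct (Hg r1 Hr1) as [r2 [Hr2 H2]].
exists (Rmin r0 r2); split; [now apply Rmin_pos|].
intros w' Hw'.
assert (Hw0 := Rlt_le_trans _ _ _ Hw' (Rmin_l _ _)).
assert (Hw2 := Rlt_le_trans _ _ _ Hw' (Rmin_r _ _)).
specialize (H1 _ (H2 _ Hw2)). rewrite (HFg _ Hw0) in H1.
rewrite (HFg w) in H1.
2:{ replace (w - w)%C with (RtoC 0) by ring. now rewrite Cmod_0. }
set (k := (g w' - g w)%C) in *. set (h := (w' - w)%C) in *.
assert (Hk : Cmod k * Cmod d <= Cmod h + e * Cmod k).
{ rewrite <- Cmod_mult. replace (k * d)%C with (h + - (h - k * d))%C by ring.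
  eapply Rle_trans; [apply Cmod_triangle|]. rewrite Cmod_opp. lra. }
assert (e <= Cmod d / 2) by apply Rmin_l.
assert (e <= eps * (Cmod d) ^ 2 / 2) by apply Rmin_r.
assert (Hk0 := Cmod_ge_0 k). assert (Hh0 := Cmod_ge_0 h).
assert (Hk2 : Cmod k * Cmod d <= 2 * Cmod h) by nra.
replace (k - h * / d)%C with (- (h - k * d) / d)%C by (field; easy).
rewrite Cmod_div, Cmod_opp by easy.
apply Rmult_le_reg_r with (Cmod d); [easy|].
replace (Cmod (h - k * d) / Cmod d * Cmod d) with (Cmod (h - k * d))
  by (field; lra).
eapply Rle_trans; [exact H1|].
apply Rle_trans with (eps * Cmod d ^ 2 / 2 * Cmod k).
{ apply Rmult_le_compat_r; easy. }
assert (0 < eps * Cmod d) by nra. nra.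
Qed.

Lemma ex_derive_C_inv (z : C) : z <> RtoC 0 ->
  ex_derive_C Cinv z.
Proof.
intros Hz. exists (- / (z * z))%C. apply is_derive_C_eps. intros eps Heps.
assert (HD : 0 < Cmod z) by now apply Cmod_gt_0.
(* The remainder is [(w - z)^2 / (w z^2)]. The first bound keeps [|w| > |z| / 2], so the second
   makes the quotient [|w - z| / |w z^2|] at most [eps]. *)
exists (Rmin (Cmod z / 2) (eps * (Cmod z) ^ 3 / 2)). split.
{ apply Rmin_pos; [lra|]. apply Rdiv_lt_0_compat; [|lra].
  apply Rmult_lt_0_compat; [easy|]. now apply pow_lt. }
intros w Hw.
assert (Hw0 := Rlt_le_trans _ _ _ Hw (Rmin_l _ _)).
assert (Hw2 := Rlt_le_trans _ _ _ Hw (Rmin_r _ _)).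
assert (Hwz : Cmod z / 2 < Cmod w).
{ assert (Cmod z <= Cmod w + Cmod (w - z)); [|lra].
  rewrite <- (Cmod_opp (w - z)).
  replace z with (w + - (w - z))%C at 1 by ring. apply Cmod_triangle. }
assert (Hwn : w <> RtoC 0) by (apply Cmod_gt_0; lra).
replace (/ w - / z - (w - z) * - / (z * z))%C
  with ((w - z) * ((w - z) / (w * (z * z))))%C by (field; easy).
rewrite Cmod_mult, Rmult_comm. apply Rmult_le_compat_r; [apply Cmod_ge_0|].
rewrite Cmod_div, !Cmod_mult by (repeat apply Cmult_neq_0; easy).
apply Rle_div_l; [apply Rmult_lt_0_compat; nra|].
apply Rle_trans with (eps * Cmod z ^ 3 / 2); [lra|].
assert (0 < eps * (Cmod z * Cmod z)) by (apply Rmult_lt_0_compat; nra). nra.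
Qed.

Lemma ex_derive_C_plus (f g : C -> C) (z : C) :
  ex_derive_C f z ->
  ex_derive_C g z ->
  ex_derive_C (fun w => f w + g w)%C z.
Proof. exact (@ex_derive_plus C_AbsRing C_NormedModule f g z). Qed.

Lemma ex_derive_C_const (a z : C) :
  ex_derive_C (fun _ : C => a) z.
Proof. exact (@ex_derive_const C_AbsRing C_NormedModule a z). Qed.

Lemma ex_derive_C_id (z : C) :
  ex_derive_C (fun w : C => w) z.
Proof. eexists; apply is_derive_C_AbsRing, is_derive_id. Qed.

Lemma ex_derive_C_mult (f g : C -> C) (z : C) :
  ex_derive_C f z ->
  ex_derive_C g z ->
  ex_derive_C (fun w => f w * g w)%C z.
Proof.
intros [df Hf] [dg Hg]; eexists; apply is_derive_C_AbsRing.
apply is_derive_C_AbsRing in Hf, Hg.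
exact (is_derive_mult (K := C_AbsRing) f g z df dg Hf Hg Cmult_comm).
Qed.

Lemma ex_derive_C_comp (f g : C -> C) (z : C) :
  ex_derive_C f (g z) ->
  ex_derive_C g z ->
  ex_derive_C (fun w => f (g w)) z.
Proof.
intros [df Hf] [dg Hg]; eexists.
apply is_derive_C_AbsRing in Hg.
exact (is_derive_comp (K := C_AbsRing) f g z df dg Hf Hg).
Qed.

Lemma ex_derive_C_div (f g : C -> C) (z : C) :
  g z <> RtoC 0 ->
  ex_derive_C f z ->
  ex_derive_C g z ->
  ex_derive_C (fun w => f w / g w)%C z.
Proof.
intros Hz Hf Hg. apply ex_derive_C_mult; [easy|].
apply (ex_derive_C_comp Cinv); [|easy]. now apply ex_derive_C_inv.
Qed.

(** * The complex exponential *)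

Lemma ex_derive_Cexp (z : C) :
  ex_derive_C Cexp z.
Proof. exists (Cexp z). apply is_derive_Cexp. Qed.

Lemma Cexp_polar (z : C) :
  Cexp z = (exp (Re z) * cos (Im z), exp (Re z) * sin (Im z)).
Proof. unfold Cexp; apply injective_projections; simpl; ring. Qed.

Lemma Cexp_plus (z w : C) : Cexp (z + w) = (Cexp z * Cexp w)%C.
Proof.
rewrite !Cexp_polar. destruct z as [a b], w as [c d]; unfold Re, Im; simpl.
rewrite exp_plus, cos_plus, sin_plus.
apply injective_projections; simpl; ring.
Qed.

Lemma Cexp_0 : Cexp (RtoC 0) = RtoC 1.
Proof.
rewrite Cexp_polar; simpl. rewrite exp_0, cos_0, sin_0, !Rmult_1_l. reflexivity.
Qed.

Definition imag (t : R) : C := (0, t).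

Lemma Cexp_imag (t : R) : Cexp (imag t) = (cos t, sin t).
Proof. rewrite Cexp_polar; simpl. now rewrite exp_0, !Rmult_1_l. Qed.

Lemma Cmod_Cexp (z : C) : Cmod (Cexp z) = exp (Re z).
Proof.
rewrite Cexp_polar. unfold Cmod; simpl.
replace (_ + _) with (exp (Re z) * exp (Re z) *
  (Rsqr (sin (Im z)) + Rsqr (cos (Im z)))) by (unfold Rsqr; ring).
rewrite sin2_cos2, Rmult_1_r. apply sqrt_square, Rlt_le, exp_pos.
Qed.

Lemma Cexp_neq_0 (z : C) : Cexp z <> RtoC 0.
Proof. apply Cmod_gt_0. rewrite Cmod_Cexp. apply exp_pos. Qed.

(** * The principal logarithm on the slit plane *)

Definition slit_plane (w : C) : Prop := 0 < Cmod w + Re w.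

(* On the slit plane [arg w = 2 atan (Im w / (|w| + Re w))] by the tangent
   half-angle formula. *)
Definition Clog (w : C) : C :=
  (ln (Cmod w), 2 * atan (Im w / (Cmod w + Re w))).

Lemma Cmod_sqr (w : C) : Cmod w * Cmod w = Re w * Re w + Im w * Im w.
Proof. pose proof (Cmod2_alt w). simpl in *. lra. Qed.

Lemma slit_plane_neq_0 (w : C) : slit_plane w -> 0 < Cmod w.
Proof.
intros Hw. apply Cmod_gt_0. intros ->. unfold slit_plane in Hw.
rewrite Cmod_0 in Hw. simpl in Hw. lra.
Qed.

(** Since [|Re w| <= |w|], failure means [Re w = - |w|], which forces [Im w = 0]. Thus [slit_plane]
    is the plane without the closed negative real axis. *)
Lemma not_slit_plane (w : C) : ~ slit_plane w -> w = RtoC (- Cmod w).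
Proof.
unfold slit_plane; intros Hw. pose proof (re_le_Cmod w) as Hr.
pose proof (Cmod_sqr w) as Hs.
assert (Hx : Re w = - Cmod w) by (unfold Rabs in Hr; destruct Rcase_abs; lra).
rewrite Hx in Hs. assert (Hy : Im w = 0) by nra.
apply injective_projections; assumption.
Qed.

Lemma Re_pos_slit_plane (w : C) : 0 < Re w -> slit_plane w.
Proof. unfold slit_plane. pose proof (Cmod_ge_0 w). lra. Qed.

Lemma Im_Clog_bound (w : C) : - PI < Im (Clog w) < PI.
Proof.
unfold Clog; simpl. pose proof (atan_bound (Im w / (Cmod w + Re w))). lra.
Qed.

(** Here [t] is the tangent of half the argument, so cosine and sine of the argument are
    [(1 - t^2) / (1 + t^2)] and [2 t / (1 + t^2)]. *)
Lemma Cexp_Clog (w : C) : slit_plane w -> Cexp (Clog w) = w.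
Proof.
intros Hw. pose proof (slit_plane_neq_0 w Hw) as H0.
unfold slit_plane in Hw. pose proof (Cmod_sqr w) as Hs.
rewrite Cexp_polar. unfold Clog; simpl Re; simpl Im. rewrite exp_ln by easy.
set (r := Cmod w) in *. set (t := Im w / (r + Re w)).
assert (Ht : 0 < 1 + Rsqr t) by (pose proof (Rle_0_sqr t); lra).
assert (Hq : sqrt (1 + Rsqr t) * sqrt (1 + Rsqr t) = 1 + Rsqr t)
  by (apply sqrt_sqrt; lra).
assert (Hq0 : 0 < sqrt (1 + Rsqr t)) by now apply sqrt_lt_R0.
(* This is [(r + x)^2 + y^2 = 2 r (r + x)] for [x^2 + y^2 = r^2], divided by [r + x]. *)
assert (Hr : (r + Re w) * (1 + Rsqr t) = 2 * r).
{ apply Rmult_eq_reg_r with (r + Re w); [|lra].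
  transitivity ((r + Re w) * (r + Re w) + Im w * Im w).
  2: nra.
  unfold t, Rsqr. field; lra. }
assert (Hy : t * (r + Re w) = Im w) by (unfold t; field; lra).
rewrite cos_2a, sin_2a, cos_atan, sin_atan.
set (q := sqrt (1 + Rsqr t)) in *.
apply injective_projections; simpl.
- change (fst w) with (Re w).
  replace (1 / q * (1 / q) - t / q * (t / q)) with ((1 - t * t) / (q * q))
    by (field; lra).
  rewrite Hq. apply Rmult_eq_reg_r with (1 + Rsqr t); [|lra].
  unfold Rdiv. rewrite !Rmult_assoc, Rinv_l by lra. unfold Rsqr in *. lra.
- change (snd w) with (Im w).
  replace (2 * (t / q) * (1 / q)) with (2 * t / (q * q)) by (field; lra).
  rewrite Hq. apply Rmult_eq_reg_r with (1 + Rsqr t); [|lra].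
  unfold Rdiv. rewrite !Rmult_assoc, Rinv_l by lra. rewrite <- Hy.
  rewrite (Rmult_assoc t), Hr. ring.
Qed.

Lemma Clog_Cexp (z : C) : - PI < Im z < PI -> Clog (Cexp z) = z.
Proof.
intros Hz. unfold Clog. rewrite Cmod_Cexp, ln_exp, Cexp_polar.
apply injective_projections; simpl; [reflexivity|].
change (snd z) with (Im z).
pose proof (exp_pos (Re z)).
assert (0 < cos (Im z / 2)) by (apply cos_gt_0; lra).
(* Half-angle identity [sin y / (1 + cos y) = tan (y / 2)]; [atan] inverts it because
   [|y / 2| < PI / 2]. *)
replace (exp (Re z) * sin (Im z) / (exp (Re z) + exp (Re z) * cos (Im z)))
  with (tan (Im z / 2)).
- rewrite atan_tan by lra. field.
- replace (Im z) with (2 * (Im z / 2)) at 2 3 by field.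
  rewrite cos_2a_cos, sin_2a. unfold tan. field.
  repeat split; apply Rgt_not_eq; [|lra..].
  replace (_ + _) with (exp (Re z) * (2 * (cos (Im z / 2) * cos (Im z / 2)))) by ring.
  repeat apply Rmult_lt_0_compat; lra.
Qed.

Lemma continuous_Cmod (w : C) :
  continuous (T := plane)
    (U := R_UniformSpace) Cmod w.
Proof.
apply (continuous_comp (fun p : R * R => fst p ^ 2 + snd p ^ 2) sqrt).
- apply (continuous_plus (V := R_NormedModule)); simpl;
    repeat apply (continuous_mult (K := R_AbsRing));
    first [apply continuous_fst | apply continuous_snd | apply continuous_const].
- apply continuous_sqrt.
Qed.

Lemma continuous_Cmod_plus_Re (w : C) :
  continuous (T := plane)
    (U := R_UniformSpace) (fun w => Cmod w + Re w) w.
Proof.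
apply (continuous_plus (V := R_NormedModule)).
- apply continuous_Cmod.
- apply continuous_fst.
Qed.

Lemma slit_plane_open (w : C) : slit_plane w ->
  exists r, 0 < r /\ forall w', Cmod (w' - w) < r -> slit_plane w'.
Proof.
intros Hw. apply locally_prod_Cmod.
apply (continuous_Cmod_plus_Re w). apply open_gt, Hw.
Qed.

Lemma Clog_continuous (w : C) : slit_plane w -> forall eps, 0 < eps ->
  exists r, 0 < r /\
    forall w', Cmod (w' - w) < r -> Cmod (Clog w' - Clog w) < eps.
Proof.
intros Hw eps Heps.
assert (He : 0 < eps / 2) by lra.
assert (H1 : continuous (T := plane)
  (U := R_UniformSpace) (fun w => ln (Cmod w)) w).
{ apply (continuous_comp Cmod ln); [apply continuous_Cmod|].
  apply continuous_ln. now apply slit_plane_neq_0. }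
assert (H2 : continuous (T := plane)
  (U := R_UniformSpace) (fun w => 2 * atan (Im w / (Cmod w + Re w))) w).
{ apply (continuous_mult (K := R_AbsRing)); [apply continuous_const|].
  apply (continuous_comp (fun w => Im w / (Cmod w + Re w)) atan);
    [|apply continuous_atan].
  apply (continuous_mult (K := R_AbsRing)); [apply continuous_snd|].
  apply (continuous_comp (fun w => Cmod w + Re w) Rinv);
    [apply continuous_Cmod_plus_Re|].
  apply continuous_Rinv. unfold slit_plane in Hw. lra. }
destruct (locally_prod_Cmod w _ (H1 _ (locally_ball _ (mkposreal _ He))))
  as [r1 [Hr1 B1]].
destruct (locally_prod_Cmod w _ (H2 _ (locally_ball _ (mkposreal _ He))))
  as [r2 [Hr2 B2]].
exists (Rmin r1 r2); split; [now apply Rmin_pos|]. intros w' Hw'.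
specialize (B1 w' (Rlt_le_trans _ _ _ Hw' (Rmin_l _ _))).
specialize (B2 w' (Rlt_le_trans _ _ _ Hw' (Rmin_r _ _))).
replace (Clog w' - Clog w)%C
  with (RtoC (fst (Clog w') - fst (Clog w)) +
        Ci * RtoC (snd (Clog w') - snd (Clog w)))%C
  by (apply injective_projections; simpl; ring).
eapply Rle_lt_trans; [apply Cmod_triangle|].
rewrite Cmod_mult, Cmod_Ci, !Cmod_R.
assert (C1 : Rabs (fst (Clog w') - fst (Clog w)) < eps / 2) by exact B1.
assert (C2 : Rabs (snd (Clog w') - snd (Clog w)) < eps / 2) by exact B2.
lra.
Qed.

Lemma ex_derive_Clog (w : C) : slit_plane w ->
  ex_derive_C Clog w.
Proof.
intros Hw. eexists. apply is_derive_C_inverse with Cexp.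
- apply is_derive_Cexp.
- apply Cexp_neq_0.
- now apply Clog_continuous.
- destruct (slit_plane_open w Hw) as [r [Hr H]].
  exists r; split; [easy|]. intros w' Hw'. now apply Cexp_Clog, H.
Qed.

(** * Moebius maps between the disc and half-planes *)

Lemma Re_div_pos (u v : C) :
  v <> RtoC 0 -> 0 < Re (u * Cconj v) -> 0 < Re (u / v).
Proof.
intros Hv Hu.
replace (u / v)%C with (RtoC (/ (Cmod v ^ 2)) * (u * Cconj v))%C.
- rewrite Cmod2_alt in *. apply Cmod_gt_0 in Hv.
  pose proof (Cmod_sqr v).
  assert (0 < / (Re v ^ 2 + Im v ^ 2)) by (apply Rinv_0_lt_compat; nra).
  rewrite re_scal_l. now apply Rmult_lt_0_compat.
- rewrite RtoC_inv by (apply pow_nonzero, Rgt_not_eq, Cmod_gt_0, Hv).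
  rewrite Cmod2_conj. field. split; [easy|]. intros H. apply Hv, Cmod_eq_0.
  now rewrite <- Cmod_conj, H, Cmod_0.
Qed.

(* Unqualified [disc] is the one of Stdlib's [Rtopology]. *)
Lemma disc_one_minus_neq_0 (z : C) : Defs.disc z -> (RtoC 1 - z)%C <> RtoC 0.
Proof.
unfold Defs.disc; intros Hz H. apply (Rlt_irrefl 1).
rewrite <- Cmod_1 at 1.
replace (RtoC 1) with (RtoC 1 - z + z)%C by ring. rewrite H, Cplus_0_l. easy.
Qed.

(** For the unit number [zeta = (c, s)] and [x = zeta^2], the expression is
    [(conj zeta + zeta z) / (1 - z)]. Multiplying the numerator by [conj (1 - z)] leaves the real
    part [c (1 - |z|^2)]. *)
Lemma half_plane_map (c s : R) (z : C) : c * c + s * s = 1 -> 0 < c -> Defs.disc z ->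
  0 < Re (Cconj (c, s) * ((RtoC 1 + (c, s) * (c, s) * z) / (RtoC 1 - z)))%C.
Proof.
intros Hcs Hc Hz.
assert (Hz1 := disc_one_minus_neq_0 z Hz). unfold Defs.disc in Hz.
replace (Cconj (c, s) * ((RtoC 1 + (c, s) * (c, s) * z) / (RtoC 1 - z)))%C
  with ((Cconj (c, s) + (c, s) * z) / (RtoC 1 - z))%C.
- apply Re_div_pos; [easy|]. pose proof (Cmod_sqr z). pose proof (Cmod_ge_0 z).
  replace (Re _) with (c * (1 - (Re z * Re z + Im z * Im z)))
    by (destruct z; simpl; ring).
  apply Rmult_lt_0_compat; nra.
- transitivity ((Cconj (c, s) + Cconj (c, s) * (c, s) * ((c, s) * z)) / (RtoC 1 - z))%C;
    [|field; easy].
  replace (Cconj (c, s) * (c, s))%C with (RtoC 1); [f_equal; ring|].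
  apply injective_projections; simpl; lra.
Qed.

(** The inverse Moebius map sends the half-plane into the disc because [|w + x|^2 - |w - 1|^2 = 4 c
    Re (conj (c, s) w)]. *)
Lemma half_plane_map_inverse (c s : R) (w : C) :
  c * c + s * s = 1 -> 0 < c -> 0 < Re (Cconj (c, s) * w)%C ->
  let x := ((c, s) * (c, s))%C in
  let v := ((w - RtoC 1) / (w + x))%C in
  (w + x)%C <> RtoC 0 /\ Defs.disc v /\
  ((RtoC 1 + x * v) / (RtoC 1 - v))%C = w.
Proof.
intros Hcs Hc Hw x v.
assert (Hp : 0 < c * Re w + s * Im w).
{ revert Hw. destruct w; simpl. lra. }
assert (Hlt : Cmod (w - RtoC 1) < Cmod (w + x)).
{ apply Rsqr_incrst_0; try apply Cmod_ge_0. unfold Rsqr. rewrite !Cmod_sqr.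
  destruct w as [p q]; unfold Re, Im in *; simpl in *.
  assert (0 < c * (c * p + s * q)) by now apply Rmult_lt_0_compat.
  assert (Hs : s * s = 1 - c * c) by lra.
  rewrite Hs. nra. }
assert (Hwx : (w + x)%C <> RtoC 0).
{ apply Cmod_gt_0. pose proof (Cmod_ge_0 (w - RtoC 1)). lra. }
(* The real part of [x + 1] is [2 c^2]; this makes [1 - v = (x + 1) / (w + x)] invertible. *)
assert (Hx1 : (x + RtoC 1)%C <> RtoC 0).
{ intros H. apply (f_equal fst) in H. unfold x in H. simpl in H. nra. }
split; [easy|]. split.
- unfold Defs.disc, v. rewrite Cmod_div by easy.
  apply Rlt_div_l; [now apply Cmod_gt_0|]. lra.
- unfold v.
  replace (RtoC 1 - (w - RtoC 1) / (w + x))%C with ((x + RtoC 1) / (w + x))%C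
    by (field; easy).
  field. easy.
Qed.

(** * From omitted directions to subordination *)

(** Rotating by [PI - t] moves the omitted ray onto the negative real axis; the principal logarithm
    applies there, and adding [i (t - PI)] undoes the rotation. *)
Lemma log_avoiding_ray (f : C -> C) (t : R) :
  analytic_on_disc f ->
  (forall z r, Defs.disc z -> 0 <= r -> f z <> (RtoC r * (cos t, sin t))%C) ->
  exists L : C -> C, analytic_on_disc L /\
    forall z, Defs.disc z -> Cexp (L z) = f z /\ t - 2 * PI < Im (L z) < t.
Proof.
intros Hf Hray.
set (rot := Cexp (imag (PI - t))).
assert (Hrot : (rot * Cexp (imag (t - PI)))%C = RtoC 1).
{ unfold rot. rewrite <- Cexp_plus, <- Cexp_0. f_equal.
  apply injective_projections; simpl; ring. }
assert (Hslit : forall z, Defs.disc z -> slit_plane (f z * rot)).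
{ intros z Hz.
  destruct (Rlt_dec 0 (Cmod (f z * rot) + Re (f z * rot))) as [H|H]; [easy|].
  apply not_slit_plane in H. exfalso.
  apply (Hray z (Cmod (f z * rot)) Hz (Cmod_ge_0 _)).
  transitivity (f z * rot * Cexp (imag (t - PI)))%C.
  { rewrite <- Cmult_assoc, Hrot. ring. }
  rewrite H at 1. rewrite Cexp_imag, cos_minus, sin_minus, cos_PI, sin_PI.
  apply injective_projections; simpl; ring. }
exists (fun z => Clog (f z * rot) + imag (t - PI))%C. split.
- intros z Hz. apply ex_derive_C_plus; [|apply ex_derive_C_const].
  apply (ex_derive_C_comp Clog (fun w => f w * rot)%C).
  + now apply ex_derive_Clog, Hslit.
  + apply ex_derive_C_mult; [now apply Hf|apply ex_derive_C_const].
- intros z Hz. split.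
  + rewrite Cexp_plus, Cexp_Clog, <- Cmult_assoc, Hrot by now apply Hslit. ring.
  + pose proof (Im_Clog_bound (f z * rot)). simpl in *. lra.
Qed.

(** Dividing [L] by [alpha] makes the strip of height [PI], so [w = exp (L / alpha)] lies in a
    half-plane that contains 1, and [phi] is the inverse Moebius map at [w]. *)
Lemma log_strip_subordinate (alpha b : R) (f L : C -> C) :
  0 < alpha -> 0 < b < PI * alpha ->
  analytic_on_disc L -> L (RtoC 0) = RtoC 0 ->
  (forall z, Defs.disc z -> Cexp (L z) = f z) ->
  (forall z, Defs.disc z -> b - PI * alpha < Im (L z) < b) ->
  exists x : C, Cmod x = 1 /\ x <> RtoC (-1) /\
    exists P : C -> C,
      power_branch (fun z => (RtoC 1 + x * z) / (RtoC 1 - z))%C alpha P /\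
      P (RtoC 0) = RtoC 1 /\ subordinate f P.
Proof.
intros Ha Hb HL HL0 HLf Hstrip.
(* The centre of the strip for [Im (L / alpha)]. The bounds on [b] give [cos tau > 0], whence
   [x = exp (2 i tau)] differs from -1. *)
set (tau := b / alpha - PI / 2).
assert (Htau : - (PI / 2) < tau < PI / 2).
{ unfold tau.
  assert (0 < b / alpha) by (apply Rdiv_lt_0_compat; lra).
  assert (b / alpha < PI) by (apply Rlt_div_l; lra). lra. }
assert (Hc : 0 < cos tau) by (apply cos_gt_0; lra).
assert (Hcs : cos tau * cos tau + sin tau * sin tau = 1).
{ pose proof (sin2_cos2 tau). unfold Rsqr in *. lra. }
set (c := cos tau) in *. set (s := sin tau) in *.
set (x := ((c, s) * (c, s))%C).
assert (Hce : Cexp (imag (- tau)) = Cconj (c, s))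
  by (rewrite Cexp_imag, cos_neg, sin_neg; reflexivity).
assert (Hinv : (Cconj (c, s) * (c, s))%C = RtoC 1)
  by (apply injective_projections; simpl; lra).
set (h := fun z => ((RtoC 1 + x * z) / (RtoC 1 - z))%C).
assert (Hh : forall z, Defs.disc z -> slit_plane (Cconj (c, s) * h z)%C)
  by (intros z Hz; apply Re_pos_slit_plane, half_plane_map; easy).
(* A logarithm of [h]: the half-plane is turned into the right half-plane, and [i tau] turns it
   back. *)
set (Lh := fun z => (Clog (Cconj (c, s) * h z) + imag tau)%C).
set (w := fun z => Cexp (RtoC (/ alpha) * L z)).
assert (Hw : forall z, Defs.disc z ->
  - (PI / 2) < Im ((RtoC (/ alpha) * L z) + imag (- tau)) < PI / 2).
{ intros z Hz. replace (Im _) with (Im (L z) / alpha - tau)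
    by (simpl; rewrite Rmult_0_l, Rplus_0_r; unfold Rdiv; fold (Im (L z)); ring).
  specialize (Hstrip z Hz). unfold tau.
  assert (Im (L z) / alpha < b / alpha).
  { apply Rmult_lt_compat_r; [now apply Rinv_0_lt_compat|lra]. }
  assert (b / alpha - PI < Im (L z) / alpha); [|lra].
  replace (b / alpha - PI) with ((b - PI * alpha) / alpha) by (field; lra).
  apply Rmult_lt_compat_r; [now apply Rinv_0_lt_compat|lra]. }
assert (Hcw : forall z,
  (Cexp ((RtoC (/ alpha) * L z) + imag (- tau)) = Cconj (c, s) * w z)%C).
{ intros z. rewrite Cexp_plus, Hce. apply Cmult_comm. }
assert (Hpos : forall z, Defs.disc z -> 0 < Re (Cconj (c, s) * w z)).
{ intros z Hz. rewrite <- Hcw, Cexp_polar. apply Rmult_lt_0_compat.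
  - apply exp_pos.
  - apply cos_gt_0; apply Hw; easy. }
assert (Hphi := fun z Hz => half_plane_map_inverse c s (w z) Hcs Hc (Hpos z Hz)).
assert (Hdisc0 : Defs.disc (RtoC 0)) by (unfold Defs.disc; rewrite Cmod_0; lra).
exists x. split; [|split].
- unfold x. rewrite Cmod_mult.
  replace (Cmod (c, s)) with 1; [ring|].
  unfold Cmod; simpl. rewrite !Rmult_1_r, Hcs. now rewrite sqrt_1.
- intros H. apply (f_equal fst) in H. unfold x in H. simpl in H. nra.
- exists (fun z => Cexp (RtoC alpha * Lh z)). split; [|split].
  + exists Lh. split; [|split]; [| |reflexivity].
    * intros z Hz. apply ex_derive_C_plus; [|apply ex_derive_C_const].
      apply (ex_derive_C_comp Clog (fun z => Cconj (c, s) * h z)%C);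
        [now apply ex_derive_Clog, Hh|].
      apply ex_derive_C_mult; [apply ex_derive_C_const|].
      apply ex_derive_C_div.
      -- now apply disc_one_minus_neq_0.
      -- apply ex_derive_C_plus; [apply ex_derive_C_const|].
         apply ex_derive_C_mult; [apply ex_derive_C_const|apply ex_derive_C_id].
      -- assert (E : forall y : C, (RtoC 1 + - RtoC 1 * y = RtoC 1 - y)%C)
           by (intros y; ring).
         apply (ex_derive_ext (K := C_AbsRing) (V := C_NormedModule) _ _ _ E).
         apply ex_derive_C_plus; [apply ex_derive_C_const|].
         apply ex_derive_C_mult; [apply ex_derive_C_const|apply ex_derive_C_id].
    * intros z Hz. unfold Lh. rewrite Cexp_plus, Cexp_Clog by now apply Hh.
      rewrite Cexp_imag. fold c s.
      transitivity (Cconj (c, s) * (c, s) * h z)%C; [ring|]. rewrite Hinv. apply Cmult_1_l.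
  (* At 0 the principal logarithm of [exp (- i tau)] is [- i tau], which cancels the added
     [i tau]. *)
  + unfold Lh. replace (h (RtoC 0)) with (RtoC 1).
    2: (unfold h; field).
    rewrite Cmult_1_r, <- Hce, Clog_Cexp by (simpl; lra).
    rewrite <- Cexp_0. f_equal.
    apply injective_projections; simpl; ring.
  + exists (fun z => (w z - RtoC 1) / (w z + x))%C.
    split; [|split; [|split]].
    * intros z Hz.
      assert (Hwd : ex_derive_C w z).
      { apply (ex_derive_C_comp Cexp); [apply ex_derive_Cexp|].
        apply ex_derive_C_mult; [apply ex_derive_C_const|now apply HL]. }
      apply ex_derive_C_div; [now apply Hphi| |].
      -- apply ex_derive_C_plus; [easy|apply ex_derive_C_const].
      -- apply ex_derive_C_plus; [easy|apply ex_derive_C_const].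
    * unfold w. rewrite HL0, Cmult_0_r, Cexp_0. unfold Cdiv. ring.
    * intros z Hz. now apply Hphi.
    (* Since [h (phi z) = w z], the principal logarithm is taken of [exp (L z / alpha - i tau)]. The
       imaginary part stays within [PI / 2], so it returns that exponent, and
       [alpha * Lh (phi z) = L z]. *)
    * intros z Hz. unfold Lh, h. destruct (Hphi z Hz) as [_ [_ Hz']].
      fold x in Hz'. rewrite Hz', <- Hcw, Clog_Cexp, <- HLf
        by (try specialize (Hw z Hz); easy || lra).
      f_equal. rewrite <- Cplus_assoc.
      replace (imag (- tau) + imag tau)%C with (RtoC 0)
        by (apply injective_projections; simpl; ring).
      rewrite Cplus_0_r, Cmult_assoc, <- RtoC_mult, Rinv_r, Cmult_1_l by lra.
      reflexivity.
Qed.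

Theorem theorem1 (alpha : R) (f : C -> C)
  (halpha : (1 < alpha <= 2)%R) (hf : class_F alpha f) :
  exists x : C,
    Cmod x = 1%R /\ x <> RtoC (-1) /\
    exists P : C -> C,
      power_branch
        (fun z : C => ((RtoC 1 + x * z) / (RtoC 1 - z))%C) alpha P /\
      P (RtoC 0) = RtoC 1 /\
      subordinate f P.
Proof.
destruct hf as [Hf _ Hnv _ _ H1
  [gamma [[beta [[Hbeta [t HT]] ->]] Hgamma]]].
(* If [f z] were a recession direction, moving from the omitted point 0 by [f z] would put [f z] in
   the complement of the image. *)
assert (Havoid : forall z r theta, Defs.disc z -> 0 <= r -> t <= theta <= t + beta ->
  f z <> (RtoC r * (cos theta, sin theta))%C).
{ intros z r theta Hz Hr Hth Hfz.
  assert (HTz : recession_cone (Defs.compl (Defs.disc_image f)) (f z))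
    by (apply HT; exists r, theta; easy).
  assert (H0 : Defs.compl (Defs.disc_image f) (RtoC 0)).
  { intros [y [Hy Hy0]]. now apply (Hnv y Hy). }
  apply (HTz _ 1 H0 ltac:(lra)). exists z. split; [easy|ring]. }
destruct (log_avoiding_ray f t Hf) as [L [HL HLf]].
{ intros z r Hz Hr. apply Havoid; try easy. lra. }
assert (Hdisc0 : Defs.disc (RtoC 0)) by (unfold Defs.disc; rewrite Cmod_0; lra).
(* Below this bound, [Im (L z) + 2 PI] would be an argument of [f z] in the avoided interval from
   [t] to [t + beta]. *)
assert (Hlow : forall z, Defs.disc z -> t + beta - 2 * PI < Im (L z)).
{ intros z Hz. destruct (HLf z Hz) as [He Hi].
  apply Rnot_le_lt. intros Hle.
  apply (Havoid z (exp (Re (L z))) (Im (L z) + 2 * PI) Hz).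
  - apply Rlt_le, exp_pos.
  - lra.
  - rewrite <- He, Cexp_polar, cos_plus, sin_plus, cos_2PI, sin_2PI.
    apply injective_projections; simpl; ring. }
set (m := L (RtoC 0)) in *.
(* As [exp m = f 0 = 1], subtracting [m] normalizes the logarithm to 0 at the origin and keeps its
   exponential. *)
assert (Hm : Cexp (- m) = RtoC 1).
{ transitivity (Cexp (- m) * f (RtoC 0))%C; [rewrite H1; ring|].
  rewrite <- (proj1 (HLf _ Hdisc0)). fold m.
  rewrite <- Cexp_plus, <- Cexp_0. f_equal. ring. }
assert (Hm1 := proj2 (HLf _ Hdisc0)). assert (Hm2 := Hlow _ Hdisc0). fold m in Hm1, Hm2.
(* [t - Im m] is the upper edge of the shifted strip, whose height [2 PI - beta] is at most
   [PI * alpha]. The value 0 at the origin lies strictly inside, which gives the bounds on this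
   edge. *)
apply (log_strip_subordinate alpha (t - Im m) f (fun z => L z + - m)%C).
- lra.
- lra.
- intros z Hz. apply ex_derive_C_plus; [now apply HL|apply ex_derive_C_const].
- unfold m. ring.
- intros z Hz. rewrite Cexp_plus, Hm, Cmult_1_r. now apply HLf.
- intros z Hz. specialize (Hlow z Hz). destruct (HLf z Hz) as [_ Hi].
  simpl in *. unfold Im in *. lra.
Qed.
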